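(* Let $(G_N)_{N\in\mathbb N}$ be a spectral expander such that $N_1=N_1(N)$ satisfies $N_1/\ln N\to\infty$. Then for every $c>0$ there exists $\varepsilon>0$ such that for all sufficiently large $N$ and all integers $t>c\min\{\sqrt N,N_1\}$, $$\operatorname{mon}(C_t,G_N)<(1-\varepsilon)\operatorname{hom}(C_t,G_N).$$
   Context: $(G_N)_{N\in\mathbb N}$ is a sequence of graphs where $G_N$ has vertex set $\{1,\dots,N\}$ and is connected, non-bipartite and $N_1$-regular, with $N_1=N_1(N)$. Let $\lambda_1(N)$ be the largest in absolute value eigenvalue of the adjacency matrix of $G_N$ among those different from $N_1$. The sequence is called a spectral expander if there is $\delta>0$ such that $|\lambda_1|/N_1<1-\delta$ for all large $N$. $C_t$ is the cycle on $t$ vertices; $\operatorname{hom}(H,G)$ and $\operatorname{mon}(H,G)$ denote the numbers of homomorphisms (edge-preserving maps $V(H)\to V(G)$) and of injective homomorphisms from $H$ to $G$. *)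

(* Defs.v *)
From HB Require Import structures.
From mathcomp Require Import all_boot all_order all_algebra.
From mathcomp Require Import all_classical all_reals all_analysis.
Set Implicit Arguments. Unset Strict Implicit. Unset Printing Implicit Defensive.
Import Order.TTheory GRing.Theory Num.Theory.
Local Open Scope ring_scope.

Definition simple_graph (V : finType) (e : rel V) : Prop :=
  (forall x y, e x y = e y x) /\ (forall x, ~~ e x x).

Definition connected_graph (V : finType) (e : rel V) : Prop :=
  forall x y, connect e x y.

Definition bipartite (V : finType) (e : rel V) : Prop :=
  exists f : V -> bool, forall x y, e x y -> f x != f y.

Definition regular (V : finType) (e : rel V) (d : nat) : Prop :=
  forall x, #|[set y | e x y]| = d.

Definition adjacency (R : nzRingType) (n : nat) (e : rel 'I_n) : 'M[R]_n :=
  \matrix_(i, j) (e i j)%:R.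

(* The cycle C_t on vertex set 'I_t: i ~ i+1 (mod t). For t >= 3 this is the
   usual cycle graph. *)
Definition cycle_graph (t : nat) : rel 'I_t :=
  fun i j => (j == ordS i) || (i == ordS j).

Definition hom_set (V W : finType) (h : rel V) (g : rel W) : {set {ffun V -> W}} :=
  [set f : {ffun V -> W} | [forall x, forall y, h x y ==> g (f x) (f y)]].

Definition graph_hom (V W : finType) (h : rel V) (g : rel W) : nat := #|hom_set h g|.

Definition graph_mon (V W : finType) (h : rel V) (g : rel W) : nat :=
  #|[set f in hom_set h g | injectiveb f]|.
Arguments cycle_graph t : clear implicits.

(* Main.v *)
(** Write d for the degree, rho < 1 for the bound on |lambda| / d off the constants
    and h for about t / 6.  The spectral gap makes A^t close to d^t times the uniform
    projection once t is a large multiple of ln N, so hom(C_t, G) = tr A^t >=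
    d^t (1 - eta), and pinning both ends of a long walk costs a factor of at most
    (1 + eta) / N.  It remains to see that a walk with many steps self-intersects
    with probability bounded below.
    If t > c d, already the first h steps must not backtrack, which costs
    (1 - 1/d)^h.  If t > c sqrt N, let S be the set of the h vertices visited first;
    a vector supported off S has squared projection onto the constants at most
    (1 - |S|/N) times its squared norm, so A contracts it by the additional factor
    1 - (1 - rho^2) |S|/N (in squared norm), and avoiding S for 2h later steps costs
    (1 - (1 - rho^2) h/N)^h.  In both cases the factor stays below a constant
    theta < 1. *)

Require Import Defs.
From HB Require Import structures.
From mathcomp Require Import all_boot all_order all_algebra.
From mathcomp Require Import ring lra zify complex.
From mathcomp Require Import all_classical all_reals all_analysis.
Import Order.TTheory GRing.Theory Num.Theory.
Local Open Scope ring_scope.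

(** * Spectral bounds *)

Definition dot {F : pzRingType} {n : nat} (u v : 'rV[F]_n) : F := (u *m v^T) 0 0.

Lemma dotE {F : pzRingType} {n} (u v : 'rV[F]_n) : dot u v = \sum_i u 0 i * v 0 i.
Proof. by rewrite /dot mxE; apply: eq_bigr => i _; rewrite mxE. Qed.

Local Open Scope sesquilinear_scope.

(** In an orthonormal eigenbasis of the complexified matrix, [A] multiplies each coordinate of [w]
    by its eigenvalue, and the coordinates at eigenvalues above [b] in absolute value vanish. The
    hypothesis mentions real eigenvectors only, so it can be checked over [F]. *)
Lemma sqnorm_symmetric_le {F : rcfType} {n} (A : 'M[F]_n) (b : F) (w : 'rV[F]_n) :
  A^T = A ->
  (forall a (v : 'rV[F]_n), v *m A = a *: v -> b < `|a| -> dot w v = 0) ->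
  dot (w *m A) (w *m A) <= b ^+ 2 * dot w w.
Proof.
move=> symA wv0.
pose toC : {rmorphism F -> F[i]} := real_complex F; pose B := map_mx toC A; pose W := map_mx toC w.
have conjR (x : F) : ((toC x)^* )%R = toC x by exact: conjc_real.
have hermB : B \is hermsymmx.
  apply: realsym_hermsym; last first.
    by apply/mxOverP => i j; rewrite mxE; apply/complex_realP; exists (A i j).
  apply/is_hermitianmxP; rewrite expr0 scale1r map_mx_id //.
  by apply/matrixP => i j; rewrite !mxE -{1}symA mxE.
have /orthomx_spectralP BE := hermitian_normalmx hermB.
have Pu := spectral_unitarymx B.
have lamR := hermitian_spectral_diag_real hermB.
have Pun := spectral_unit B.
set P := spectralmx B in BE Pu Pun; set lam := spectral_diag B in BE lamR.
have PB : P *m B = diag_mx lam *m P.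
  by rewrite {1}BE !mulmxA mulmxV ?mul1mx.
have PK : P^t* *m P = 1%:M by rewrite -invmx_unitary // mulVmx.
pose c := W *m P^t*.
have WE : W = c *m P by rewrite -mulmxA PK mulmx1.
have c0 i : toC b < `|lam 0 i| -> c 0 i = 0.
  have /complex_realP[l lE] : lam 0 i \is Num.real by apply: (mxOverP lamR).
  rewrite lE normc_def /= expr0n /= addr0 sqrtr_sqr ltcR => bl.
  (* The eigenvalue l is real, so the real and imaginary parts of a complex
     eigenvector are themselves real eigenvectors, to which [wv0] applies. *)
  pose re := map_mx (@complex.Re F) (row i P); pose im := map_mx (@complex.Im F) (row i P).
  have PBi j : \sum_k P i k * toC (A k j) = toC l * P i j.
    have /matrixP/(_ i j) := PB; rewrite mul_diag_mx !mxE lE => <-.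
    by apply: eq_bigr => k _; rewrite mxE.
  have reE : re *m A = l *: re.
    apply/rowP => j; rewrite !mxE.
    have /(congr1 (@complex.Re F)) := PBi j; rewrite (big_morph _ (raddfD _) (raddf0 _)) /=.
    case: (P i j) => x y /=; rewrite mul0r subr0 => <-.
    by apply: eq_bigr => k _; rewrite !mxE; case: (P i k) => ? ? /=; rewrite mulr0 subr0.
  have imE : im *m A = l *: im.
    apply/rowP => j; rewrite !mxE.
    have /(congr1 (@complex.Im F)) := PBi j; rewrite (big_morph _ (raddfD _) (raddf0 _)) /=.
    case: (P i j) => x y /=; rewrite mul0r addr0 => <-.
    by apply: eq_bigr => k _; rewrite !mxE; case: (P i k) => ? ? /=; rewrite mulr0 add0r.
  have := wv0 _ _ reE bl; have := wv0 _ _ imE bl; rewrite !dotE => im0 re0.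
  (* [c 0 i] is the Hermitian product of [w] with row [i] of [P]; conjugating that row produces the
     minus sign. *)
  have -> : c 0 i = toC (\sum_j w 0 j * re 0 j) - 'i * toC (\sum_j w 0 j * im 0 j).
    rewrite !rmorph_sum mulr_sumr -sumrB mxE; apply: eq_bigr => j _.
    rewrite !mxE /=; case: (P i j) => x y /=.
    rewrite /toC -complexiE; apply/eqP; rewrite eq_complex /=; apply/andP.
    by split; rewrite ?(mul0r, mulr0, mul1r, subr0, addr0, add0r, oppr0, mulrN).
  by rewrite im0 re0 rmorph0 mulr0 subr0.
have normE (x : 'rV[F]_n) : toC (dot x x) = \sum_i `|toC (x 0 i)| ^+ 2.
  rewrite dotE rmorph_sum; apply: eq_bigr => i _.
  by rewrite rmorphM normCK conjR.
have normP (Y X : 'rV_n) : X = Y *m P -> \sum_i `|X 0 i| ^+ 2 = \sum_i `|Y 0 i| ^+ 2.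
  have nE (Z : 'rV[F[i]]_n) : \sum_i `|Z 0 i| ^+ 2 = (Z *m Z^t*) 0 0.
    by rewrite mxE; apply: eq_bigr => i _; rewrite !mxE normCK.
  move=> ->; rewrite !nE trmx_mul map_mxM mulmxA -[Y *m P *m _]mulmxA.
  by rewrite (unitarymxP Pu) mulmx1.
have WA : map_mx toC (w *m A) = (\row_i (c 0 i * lam 0 i)) *m P.
  rewrite map_mxM -/W -/B {1}WE -mulmxA PB mulmxA mul_mx_diag.
  by congr (_ *m _); apply/rowP => i; rewrite !mxE.
have sumW (x : 'rV[F]_n) Y : map_mx toC x = Y *m P ->
    toC (dot x x) = \sum_i `|Y 0 i| ^+ 2.
  move=> /normP <-; rewrite normE; apply: eq_bigr => i _; by rewrite mxE.
suff : toC (dot (w *m A) (w *m A)) <= toC (b ^+ 2 * dot w w) by rewrite lecR.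
rewrite rmorphM (sumW _ _ WA) (sumW _ _ WE) mulr_sumr.
apply: ler_sum => i _; rewrite mxE normrM exprMn mulrC.
have /complex_realP[l lE] : lam 0 i \is Num.real by apply: (mxOverP lamR).
have [bl|bl] := ltP b `|l|.
  rewrite c0 ?normr0 ?expr0n ?mulr0 //.
  by rewrite lE normc_def /= expr0n /= addr0 sqrtr_sqr ltcR.
apply: ler_wpM2r; first by rewrite exprn_ge0.
rewrite lE normc_def /= expr0n /= addr0 sqrtr_sqr.
(* In this branch [b] is nonnegative because it bounds [|l|]. *)
by rewrite -rmorphXn lecR ler_sqr ?nnegrE // (le_trans _ bl).
Qed.

Lemma dot_sumr {F : pzRingType} {n} (u : 'rV[F]_n) : dot u (const_mx 1) = \sum_i u 0 i.
Proof. by rewrite dotE; apply: eq_bigr => i _; rewrite mxE mulr1. Qed.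

Lemma dotC {F : comPzRingType} {n} (u v : 'rV[F]_n) : dot u v = dot v u.
Proof. by rewrite !dotE; apply: eq_bigr => i _; rewrite mulrC. Qed.

Lemma dot_mulmx {F : comPzRingType} {n} (u v : 'rV[F]_n) (M : 'M[F]_n) :
  dot (u *m M) v = dot u (v *m M^T).
Proof. by rewrite /dot trmx_mul trmxK mulmxA. Qed.

Lemma dot_ge0 {F : realDomainType} {n} (u : 'rV[F]_n) : 0 <= dot u u.
Proof. by rewrite dotE sumr_ge0 // => i _; rewrite -expr2 sqr_ge0. Qed.

Lemma cauchy_schwarz_sum {F : realFieldType} {I : finType} (P : pred I) (f g : I -> F) :
  (\sum_(i | P i) f i * g i) ^+ 2 <= (\sum_(i | P i) f i ^+ 2) * (\sum_(i | P i) g i ^+ 2).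
Proof.
set x := \sum_(i | P i) f i * g i; set a := \sum_(i | P i) f i ^+ 2.
set b := \sum_(i | P i) g i ^+ 2.
have b0 : 0 <= b by apply: sumr_ge0 => i _; exact: sqr_ge0.
have quad s t : 0 <= s ^+ 2 * a - s * t * x *+ 2 + t ^+ 2 * b.
  have -> : s ^+ 2 * a - s * t * x *+ 2 + t ^+ 2 * b =
      \sum_(i | P i) (s * f i - t * g i) ^+ 2.
    rewrite !mulr_sumr -sumrMnl -sumrB -big_split; apply: eq_bigr => i _ /=; ring.
  by apply: sumr_ge0 => i _; exact: sqr_ge0.
have [b_eq0|bN0] := eqVneq b 0.
  have g0 i : P i -> g i = 0.
    move=> Pi; apply/eqP; rewrite -sqrf_eq0; move/eqP: b_eq0.
    by rewrite psumr_eq0 => [/allP/(_ i)|? _]; rewrite ?mem_index_enum ?Pi ?sqr_ge0 //; apply.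
  rewrite b_eq0 mulr0 /x big1 ?expr0n // => i Pi; by rewrite g0 ?mulr0.
have b_gt0 : 0 < b by rewrite lt_def bN0.
(* At this point the quadratic form equals [b] times [a * b - x ^+ 2], and [b] is positive. *)
have := quad b x.
have -> : b ^+ 2 * a - b * x * x *+ 2 + x ^+ 2 * b = b * (a * b - x ^+ 2) by ring.
by rewrite pmulr_rge0 // subr_ge0.
Qed.

Lemma cauchy_schwarz_dot {F : realFieldType} {n} (u v : 'rV[F]_n) :
  dot u v ^+ 2 <= dot u u * dot v v.
Proof. by rewrite !dotE; exact: (cauchy_schwarz_sum xpredT). Qed.

(** The spectral gap as an operator bound on the orthogonal complement of the constants, a form that
    passes directly to powers of [A]. *)
Definition expander_mx {F : numDomainType} {n} (A : 'M[F]_n) (d rho : F) : Prop :=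
  [/\ A^T = A, const_mx 1 *m A = d *: (const_mx 1 : 'rV_n) &
    forall w : 'rV_n, dot w (const_mx 1) = 0 ->
      dot (w *m A) (w *m A) <= (rho * d) ^+ 2 * dot w w].

Lemma expander_mx_exp {F : realFieldType} {n} (A : 'M[F]_n) (d rho : F) (l : nat) :
  expander_mx A d rho -> expander_mx (A ^+ l) (d ^+ l) (rho ^+ l).
Proof.
move=> [symA A1 Aw].
elim: l => [|l [symAl Al1 Alw]].
  split; first exact: trmx1.
    by rewrite !expr0 mulmx1 scale1r.
  by move=> w _; rewrite !expr0 mulr1 expr1n mul1r mulmx1.
split.
- by rewrite [in LHS]exprSr trmx_mul symAl symA exprS.
- by rewrite exprSr mulmxA Al1 -scalemxAl A1 scalerA -exprSr.
- move=> w w0; rewrite exprSr mulmxA.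
  have w1 : dot (w *m A ^+ l) (const_mx 1) = 0.
    by rewrite dot_mulmx symAl Al1 /dot linearZ /= -scalemxAr mxE -/(dot w _) w0 mulr0.
  apply: le_trans (Aw _ w1) _.
  rewrite (exprS rho) (exprS d) mulrACA (exprMn 2 (rho * d)) -(mulrA ((rho * d) ^+ 2)).
  by apply: ler_wpM2l (Alw _ w0); exact: sqr_ge0.
Qed.

(** Pythagoras: [A] respects the splitting of [v] into its mean part and the rest [w], and the
    squared sum over [n] is the squared norm of the mean part. *)
Lemma sqnorm_expander_le {F : realFieldType} {n} (A : 'M[F]_n) (d rho : F) (v : 'rV[F]_n) :
  (0 < n)%N -> expander_mx A d rho ->
  dot (v *m A) (v *m A) <=
    d ^+ 2 * (rho ^+ 2 * dot v v + (1 - rho ^+ 2) * ((\sum_i v 0 i) ^+ 2 / n%:R)).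
Proof.
move=> n0 [symA A1 Aw].
have nN0 : n%:R != 0 :> F by rewrite pnatr_eq0 -lt0n.
pose s := (\sum_i v 0 i); pose m := s / n%:R.
pose w := v - m *: const_mx 1.
have vE : v = m *: const_mx 1 + w by rewrite addrC subrK.
have dotDl (x y z : 'rV[F]_n) : dot (x + y) z = dot x z + dot y z.
  by rewrite /dot mulmxDl mxE.
have dotZl a (x y : 'rV[F]_n) : dot (a *: x) y = a * dot x y.
  by rewrite /dot -scalemxAl mxE.
have dot11 : dot (const_mx 1 : 'rV[F]_n) (const_mx 1) = n%:R.
  rewrite dot_sumr (eq_bigr (fun=> 1)) ?sumr_const ?card_ord // => i _; by rewrite mxE.
have w0 : dot w (const_mx 1) = 0.
  rewrite /w dotDl -scaleNr dotZl dot11 dot_sumr -/s /m; by field.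
have vAE : v *m A = (m * d) *: const_mx 1 + w *m A.
  by rewrite {1}vE mulmxDl -scalemxAl A1 scalerA.
have wA0 : dot (w *m A) (const_mx 1) = 0.
  by rewrite dot_mulmx symA A1 dotC dotZl dotC w0 mulr0.
have expand x (u : 'rV[F]_n) : dot u (const_mx 1) = 0 ->
    dot (x *: const_mx 1 + u) (x *: const_mx 1 + u) = x ^+ 2 * n%:R + dot u u.
  move=> u0; rewrite dotDl dotZl (dotC (const_mx 1)) (dotC u) !dotDl !dotZl dot11.
  rewrite u0 (dotC (const_mx 1) u) u0; ring.
rewrite vAE expand //.
have -> : dot v v = m ^+ 2 * n%:R + dot w w by rewrite {1 2}vE expand.
have -> : s ^+ 2 / n%:R = m ^+ 2 * n%:R by rewrite /m; field.
have := Aw _ w0.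
have -> : d ^+ 2 * (rho ^+ 2 * (m ^+ 2 * n%:R + dot w w) + (1 - rho ^+ 2) * (m ^+ 2 * n%:R))
  = (m * d) ^+ 2 * n%:R + (rho * d) ^+ 2 * dot w w by ring.
by rewrite lerD2l.
Qed.

(** A point mass has sum and norm 1: its mean part contributes [n^-1], and the rest decays like
    [rho ^+ (2 * l)]. *)
Lemma sqnorm_delta_expander_le {F : realFieldType} {n} (A : 'M[F]_n) (d rho : F) (x : 'I_n) l :
  expander_mx A d rho ->
  dot (delta_mx 0 x *m A ^+ l) (delta_mx 0 x *m A ^+ l) <=
    d ^+ (2 * l) * (n%:R^-1 + rho ^+ (2 * l)).
Proof.
move=> /(expander_mx_exp _ _ _ l) Al.
have n0 : (0 < n)%N by case: x => m /=; case: (n).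
apply: le_trans (sqnorm_expander_le _ _ _ _ n0 Al) _.
have -> : \sum_i (delta_mx 0 x : 'rV[F]_n) 0 i = 1.
  rewrite (bigD1 x) //= big1 ?addr0 ?mxE ?eqxx // => i ix.
  by rewrite mxE (negPf ix) andbF.
have -> : dot (delta_mx 0 x : 'rV[F]_n) (delta_mx 0 x) = 1.
  by rewrite /dot trmx_delta mul_delta_mx mxE !eqxx.
rewrite -!exprM (mulnC l) mulr1 expr1n mul1r.
have d0 : 0 <= d ^+ (2 * l) by rewrite exprM exprn_ge0 // sqr_ge0.
have r0 : 0 <= rho ^+ (2 * l) by rewrite exprM exprn_ge0 // sqr_ge0.
apply: ler_wpM2l => //.
have i0 : 0 <= n%:R^-1 :> F by rewrite invr_ge0.
nra.
Qed.

(** * Walks that avoid a vertex set *)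

Definition avoid_mx {F : pzRingType} {n} (S : {set 'I_n}) : 'M[F]_n :=
  diag_mx (\row_i (i \notin S)%:R).

Lemma mul_avoid_mxE {F : pzRingType} {n} (S : {set 'I_n}) (v : 'rV[F]_n) i :
  (v *m avoid_mx S) 0 i = v 0 i * (i \notin S)%:R.
Proof. by rewrite /avoid_mx mul_mx_diag !mxE. Qed.

(** Cauchy-Schwarz over the coordinates off [S] bounds the mean part by the fraction [1 - |S| / n]
    of the squared norm; the factor is the resulting combination of 1 and [rho ^+ 2]. *)
Lemma sqnorm_avoid_expander_le {F : realFieldType} {n} (A : 'M[F]_n) (d rho : F) S
    (v : 'rV[F]_n) :
  (0 < n)%N -> expander_mx A d rho -> rho ^+ 2 <= 1 ->
  dot (v *m (avoid_mx S *m A)) (v *m (avoid_mx S *m A)) <=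
    d ^+ 2 * (1 - (1 - rho ^+ 2) * (#|S|%:R / n%:R)) * dot v v.
Proof.
move=> n0 HA rho1; rewrite mulmxA.
apply: le_trans (sqnorm_expander_le _ _ _ _ n0 HA) _.
set u := v *m avoid_mx S.
have uv : dot u u <= dot v v.
  rewrite !dotE; apply: ler_sum => i _; rewrite mul_avoid_mxE.
  by case: (i \notin S); rewrite ?mulr1 ?mulr0 // -expr2 sqr_ge0.
have uu : dot u u = \sum_(i | i \notin S) u 0 i ^+ 2.
  rewrite dotE [RHS]big_mkcond; apply: eq_bigr => i _; rewrite mul_avoid_mxE expr2.
  by case: (i \notin S); rewrite ?mulr0.
have s2 : (\sum_i u 0 i) ^+ 2 <= (n%:R - #|S|%:R) * dot u u.
  have -> : \sum_i u 0 i = \sum_(i | i \notin S) 1 * u 0 i.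
    rewrite [RHS]big_mkcond; apply: eq_bigr => i _; rewrite mul_avoid_mxE.
    by case: (i \notin S); rewrite ?mulr0 ?mul1r.
  apply: le_trans (cauchy_schwarz_sum _ _ _) _; rewrite uu.
  apply: ler_wpM2r; first by apply: sumr_ge0 => i _; exact: sqr_ge0.
  rewrite (eq_bigr (fun=> 1)) => [|i _]; last by rewrite expr1n.
  rewrite sumr_const -natrB ?ler_nat; last by rewrite -[X in (_ <= X)%N]card_ord max_card.
  have := cardC (mem S); rewrite card_ord => cS.
  by rewrite -[X in (_ <= X - _)%N]cS addKn.
have n0' : 0 < n%:R :> F by rewrite ltr0n.
have q : (\sum_i u 0 i) ^+ 2 / n%:R <= (1 - #|S|%:R / n%:R) * dot u u.
  rewrite ler_pdivrMr //; apply: le_trans s2 _.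
  suff -> : (1 - #|S|%:R / n%:R) * dot u u * n%:R = (n%:R - #|S|%:R) * dot u u by [].
  by field; rewrite gt_eqF.
have sn : #|S|%:R / n%:R <= 1 :> F.
  by rewrite ler_pdivrMr // mul1r ler_nat -[X in (_ <= X)%N]card_ord max_card.
have g0 : 0 <= 1 - (1 - rho ^+ 2) * (#|S|%:R / n%:R).
  have : 0 <= #|S|%:R / n%:R :> F by rewrite divr_ge0.
  have := sqr_ge0 rho; set x := _ / _ in sn *; nra.
rewrite -mulrA; apply: ler_wpM2l; first exact: sqr_ge0.
apply: le_trans (_ : _ <= (1 - (1 - rho ^+ 2) * (#|S|%:R / n%:R)) * dot u u) _; last first.
  exact: ler_wpM2l.
have := sqr_ge0 rho; set x := _ / _ in q *; set y := _ / _ in q g0 sn *.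
nra.
Qed.

(* The number 2s of avoiding steps is even so that Cauchy-Schwarz, which bounds the
   square of the entry, needs no square root of the factor per step. *)
Lemma expander_entry_le {F : realFieldType} {n} (A : 'M[F]_n) (d rho eta : F)
    (S : {set 'I_n}) (g s h : nat) (x y : 'I_n) :
  expander_mx A d rho -> 0 <= d -> 0 <= rho <= 1 -> 0 <= eta ->
  n%:R * rho ^+ g <= eta -> n%:R * rho ^+ h <= eta ->
  (A ^+ g *m (A *m avoid_mx S) ^+ (2 * s) *m A ^+ h) y x <=
    d ^+ (g + 2 * s + h) * ((1 + eta) / n%:R *
      (1 - (1 - rho ^+ 2) * (#|S|%:R / n%:R)) ^+ s).
Proof.
move=> HA d0 /andP[rho0 rho1] eta0 Hg Hh.
have n0 : (0 < n)%N by case: x => m /=; case: (n).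
have n0' : 0 < n%:R :> F by rewrite ltr0n.
have rho21 : rho ^+ 2 <= 1 by rewrite expr_le1.
have sn : #|S|%:R / n%:R <= 1 :> F.
  by rewrite ler_pdivrMr // mul1r ler_nat -[X in (_ <= X)%N]card_ord max_card.
set ga := 1 - _ * _.
have g0 : 0 <= ga.
  have : 0 <= #|S|%:R / n%:R :> F by rewrite divr_ge0.
  have := sqr_ge0 rho; rewrite /ga; set z := _ / _ in sn *; nra.
have [symA _ _] := HA.
have symX l : (A ^+ l)^T = A ^+ l by case: (expander_mx_exp _ _ _ l HA).
have trX l : ((A *m avoid_mx S) ^+ l)^T = (avoid_mx S *m A) ^+ l.
  elim: l => [|l IH]; first exact: trmx1.
  by rewrite [in LHS]exprS trmx_mul IH trmx_mul symA tr_diag_mx exprSr.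
pose v := (delta_mx 0 y : 'rV[F]_n) *m A ^+ g.
pose u := (delta_mx 0 x : 'rV[F]_n) *m A ^+ h.
(* The last two blocks move to the other side of the inner product; transposition turns
   [A *m avoid_mx S] into [avoid_mx S *m A]. *)
have -> : (A ^+ g *m (A *m avoid_mx S) ^+ (2 * s) *m A ^+ h) y x =
    dot v (u *m (avoid_mx S *m A) ^+ (2 * s)).
  rewrite /v /u /dot trmx_mul trmx_mul symX -trX trmxK trmx_delta !mulmxA.
  by rewrite -colE -!mulmxA -rowE !mxE.

(* Mixing: the hypothesis on [rho ^+ l] absorbs the decaying term into [eta / n]. *)
have bnd l z : n%:R * rho ^+ l <= eta ->
    dot (delta_mx 0 z *m A ^+ l) (delta_mx 0 z *m A ^+ l) <=
      d ^+ (2 * l) * ((1 + eta) / n%:R).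
  move=> Hl; apply: le_trans (sqnorm_delta_expander_le _ _ _ _ _ HA) _.
  apply: ler_wpM2l; first exact: exprn_ge0.
  rewrite ler_pdivlMr // mulrDl mulVf ?gt_eqF // lerD2l mulrC.
  apply: le_trans Hl; apply: ler_wpM2l; first exact: ltW.
  by rewrite mul2n -addnn exprD ler_piMr ?exprn_ge0 // exprn_ile1.
have bndr r (z : 'rV_n) : dot (z *m (avoid_mx S *m A) ^+ r) (z *m (avoid_mx S *m A) ^+ r)
    <= (d ^+ 2 * ga) ^+ r * dot z z.
  elim: r => [|r IH]; first by rewrite !expr0 mulmx1 mul1r.
  rewrite exprSr mulmxA exprS.
  apply: le_trans (sqnorm_avoid_expander_le _ _ _ _ _ n0 HA rho21) _.
  rewrite -(mulrA (d ^+ 2 * ga)); apply: ler_wpM2l; last exact: IH.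
  by rewrite mulr_ge0 ?sqr_ge0.
have e0 : 0 <= (1 + eta) / n%:R by rewrite divr_ge0 ?addr_ge0 // ltW.
apply: le_trans (ler_norm _) _.
have rhs0 : 0 <= d ^+ (g + 2 * s + h) * ((1 + eta) / n%:R * ga ^+ s).
  by rewrite mulr_ge0 ?exprn_ge0 // mulr_ge0 ?exprn_ge0.
rewrite -ler_sqr ?nnegrE ?normr_ge0 //.
rewrite real_normK ?num_real //.
apply: le_trans (cauchy_schwarz_dot _ _) _.
apply: le_trans (_ : _ <= (d ^+ (2 * g) * ((1 + eta) / n%:R)) *
   ((d ^+ 2 * ga) ^+ (2 * s) * (d ^+ (2 * h) * ((1 + eta) / n%:R)))) _.
  apply: ler_pM; rewrite ?dot_ge0 ?bnd //.
  apply: le_trans (bndr _ _) _; apply: ler_wpM2l; last exact: bnd.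
  by rewrite exprn_ge0 // mulr_ge0 ?sqr_ge0.
rewrite (mulnC 2 s) (mulnC 2 g) (mulnC 2 h) !exprM.
rewrite le_eqVlt; apply/orP; left; apply/eqP.
have -> : d ^+ (g + s * 2 + h) = d ^+ g * (d ^+ s) ^+ 2 * d ^+ h.
  by rewrite !exprD exprM.
have -> : (d ^+ 2 * ga) ^+ s = (d ^+ s) ^+ 2 * ga ^+ s.
  by rewrite exprMn -!exprM mulnC.
ring.
Qed.

(** * Adjacency matrices of connected regular graphs *)

Lemma adjacency_row_sum {F : nzRingType} {n} (e : rel 'I_n) d x :
  regular e d -> \sum_y (e x y)%:R = d%:R :> F.
Proof.
move=> reg; rewrite -natr_sum.
have -> : (\sum_y e x y)%N = #|[set y | e x y]|.
  by rewrite -sum1_card [RHS]big_mkcond; apply: eq_bigr => y _; rewrite inE; case: (e x y).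
by rewrite reg.
Qed.

Lemma top_eigenvector_const {F : realFieldType} {n} (e : rel 'I_n) d (v : 'rV[F]_n) :
  simple_graph e -> connected_graph e -> regular e d ->
  v *m adjacency F e = d%:R *: v -> forall x y, v 0 x = v 0 y.
Proof.
move=> [esym _] conn reg vA.
(* The Dirichlet form of an eigenvector for the eigenvalue d vanishes. *)
have dirichlet : \sum_x \sum_y (e x y)%:R * (v 0 x - v 0 y) ^+ 2 = 0.
  have S1 : \sum_x \sum_y (e x y)%:R * v 0 x ^+ 2 = d%:R * \sum_x v 0 x ^+ 2.
    rewrite mulr_sumr; apply: eq_bigr => x _; by rewrite -mulr_suml (adjacency_row_sum _ _ _ reg).
  have S2 : \sum_x \sum_y (e x y)%:R * v 0 y ^+ 2 = d%:R * \sum_x v 0 x ^+ 2.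
    rewrite exchange_big -S1; apply: eq_bigr => x _; apply: eq_bigr => y _.
    by rewrite esym.
  have S3 : \sum_x \sum_y (e x y)%:R * (v 0 x * v 0 y) = d%:R * \sum_x v 0 x ^+ 2.
    rewrite exchange_big mulr_sumr; apply: eq_bigr => y _.
    have /rowP/(_ y) := vA; rewrite !mxE => vAy.
    rewrite expr2 mulrA -vAy mulr_suml; apply: eq_bigr => x _.
    by rewrite mxE; ring.
  transitivity (\sum_x \sum_y ((e x y)%:R * v 0 x ^+ 2 + (e x y)%:R * v 0 y ^+ 2
      - 2 * ((e x y)%:R * (v 0 x * v 0 y)))).
    by apply: eq_bigr => x _; apply: eq_bigr => y _; ring.
  under eq_bigr do rewrite sumrB big_split -mulr_sumr.
  rewrite sumrB big_split -mulr_sumr S1 S2 S3 /=; ring.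
have edge x y : e x y -> v 0 x = v 0 y.
  move=> exy; apply/eqP; rewrite -subr_eq0 -sqrf_eq0.
  have term0 a b : 0 <= (e a b)%:R * (v 0 a - v 0 b) ^+ 2.
    by rewrite mulr_ge0 ?sqr_ge0.
  have /psumr_eq0P := dirichlet => /(_ (fun a _ => sumr_ge0 _ (fun b _ => term0 a b))).
  move=> /(_ x isT) /psumr_eq0P => /(_ (fun b _ => term0 x b)) /(_ y isT).
  by rewrite exy mul1r => ->.
move=> x y; have /connectP[p] := conn x y.
elim: p x => [|z p IH] x /= => [_ -> //|/andP[/edge -> pz] yE].
exact: IH.
Qed.

(** An eigenvalue above [rho * d] in absolute value can only be [d], whose eigenvectors are constant
    by connectedness, hence orthogonal to any [w] of sum zero. *)
Lemma expander_adjacency {F : rcfType} {n} (e : rel 'I_n) d (rho : F) :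
  simple_graph e -> connected_graph e -> regular e d ->
  (forall a, eigenvalue (adjacency F e) a -> a != d%:R -> `|a| <= rho * d%:R) ->
  expander_mx (adjacency F e) d%:R rho.
Proof.
move=> sg conn reg eig; have [esym _] := sg.
have symA : (adjacency F e)^T = adjacency F e.
  by apply/matrixP => i j; rewrite !mxE esym.
split=> //.
  apply/rowP => i; rewrite !mxE mulr1 -(adjacency_row_sum _ _ i reg).
  by apply: eq_bigr => j _; rewrite !mxE mul1r esym.
move=> w w1; apply: sqnorm_symmetric_le => // a v vA av.
have [->|v0] := eqVneq v 0; first by rewrite /dot trmx0 mulmx0 mxE.
have eigA : eigenvalue (adjacency F e) a by apply/eigenvalueP; exists v.
have [ad|ad] := eqVneq a d%:R; last by rewrite ltNge eig in av.
rewrite ad in vA; have vc := top_eigenvector_const _ _ _ sg conn reg vA.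
case: n => [|n] in e sg conn reg eig esym symA w w1 v vA av v0 eigA vc *.
  by rewrite dotE big_ord0.
rewrite dotE (eq_bigr (fun i => w 0 i * v 0 0)) => [|i _]; last by rewrite (vc i 0).
by rewrite -mulr_suml -dot_sumr w1 mul0r.
Qed.

(** Each diagonal entry is bounded below: the mean part of the point mass at [x] returns
    [d ^+ t / n], and by Cauchy-Schwarz the rest contributes at most [d ^+ t * rho ^+ t] in absolute
    value. *)
Lemma expander_trace_ge {F : realFieldType} {n} (A : 'M[F]_n) (d rho : F) t :
  (0 < n)%N -> expander_mx A d rho -> 0 <= d -> 0 <= rho ->
  d ^+ t * (1 - n%:R * rho ^+ t) <= \tr (A ^+ t).
Proof.
move=> n0 HA d0 rho0.
have nN0 : n%:R != 0 :> F by rewrite pnatr_eq0 -lt0n.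
have [_ At1 Atw] := expander_mx_exp _ _ _ t HA.
have diag x : d ^+ t * (n%:R^-1 - rho ^+ t) <= (A ^+ t) x x.
  pose ex : 'rV[F]_n := delta_mx 0 x.
  pose w := ex - n%:R^-1 *: const_mx 1.
  have sume : \sum_i ex 0 i = 1.
    rewrite (bigD1 x) //= big1 ?addr0 ?mxE ?eqxx // => i ix.
    by rewrite mxE (negPf ix) andbF.
  have w0 : dot w (const_mx 1) = 0.
    have wE i : w 0 i = ex 0 i - n%:R^-1 by rewrite !mxE mulr1.
    rewrite dot_sumr; under eq_bigr do rewrite wE.
    by rewrite sumrB sume sumr_const card_ord -[_ *+ n]mulr_natl mulfV ?subrr.
  have dote (u : 'rV[F]_n) : dot u ex = u 0 x.
    rewrite dotE (bigD1 x) //= big1 ?addr0 ?mxE ?eqxx ?mulr1 // => i ix.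
    by rewrite !mxE (negPf ix) andbF mulr0.
  have -> : (A ^+ t) x x = d ^+ t / n%:R + dot (w *m A ^+ t) ex.
    have exE : ex = n%:R^-1 *: const_mx 1 + w by rewrite addrC subrK.
    have <- : dot (ex *m A ^+ t) ex = (A ^+ t) x x by rewrite dote -rowE mxE.
    rewrite {1}exE mulmxDl -scalemxAl At1 !dote mxE; congr (_ + _).
    by rewrite !mxE mulr1 mulrC.
  rewrite mulrBr lerD2l lerNl.
  apply: le_trans (ler_norm _) _; rewrite normrN.
  have rhs0 : 0 <= d ^+ t * rho ^+ t by rewrite mulr_ge0 ?exprn_ge0.
  rewrite -ler_sqr ?nnegrE ?normr_ge0 // real_normK ?num_real //.
  apply: le_trans (cauchy_schwarz_dot _ _) _.
  have -> : dot ex ex = 1 by rewrite dote mxE !eqxx.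
  rewrite mulr1; apply: le_trans (Atw _ w0) _.
  rewrite (mulrC (rho ^+ t)) ler_piMr ?sqr_ge0 //.
  have ww : dot w w = 1 - n%:R^-1.
    rewrite {2}/w /dot linearB /= mulmxBr mxE -/(dot w ex) dote.
    rewrite linearZ /= -scalemxAr !mxE -/(dot w _).
    have := w0; rewrite /dot mxE => ->.
    by rewrite !eqxx mulr0 subr0 mulr1.
  by rewrite ww gerBl invr_ge0.
apply: le_trans (_ : _ <= \sum_(x < n) (d ^+ t * (n%:R^-1 - rho ^+ t))) _; last first.
  by apply: ler_sum => x _; exact: diag.
rewrite sumr_const card_ord -[_ *+ n]mulr_natl le_eqVlt; apply/orP; left; apply/eqP.
by field.
Qed.

(** * Counting closed walks *)

Lemma ler_bool {F : numDomainType} (a b : bool) : (a -> b) -> a%:R <= b%:R :> F.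
Proof. by case: a => [->|_] //; rewrite ler0n. Qed.

(** Here and in the next two lemmas the summand is a function of the underlying sequence, so that
    cutting a walk into blocks needs no casts between tuple lengths. *)
Lemma sum_tuple0 {F : nmodType} {T : finType} (f : seq T -> F) :
  \sum_(s : 0.-tuple T) f s = f [::].
Proof. by rewrite (big_pred1 [tuple]) // => s; rewrite [s]tuple0 /= eqxx. Qed.

Lemma sum_tuple_cons {F : nmodType} {T : finType} l (f : seq T -> F) :
  \sum_(s : l.+1.-tuple T) f s = \sum_z \sum_(s : l.-tuple T) f (z :: s).
Proof.
rewrite pair_big /= (reindex (fun p : T * l.-tuple T => [tuple of p.1 :: p.2])) //=.
exists (fun s => (thead s, [tuple of behead s])) => [[z s] _|s _] /=.
  by congr pair; apply/val_inj.
by rewrite -tuple_eta.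
Qed.

Lemma sum_tuple_cat {F : nmodType} {T : finType} l k (f : seq T -> F) :
  \sum_(s : (l + k).-tuple T) f s =
  \sum_(s : l.-tuple T) \sum_(s' : k.-tuple T) f (s ++ s').
Proof.
elim: l f => [|l IH] f; first by rewrite (sum_tuple0 (fun s => \sum_(s' : k.-tuple T) f (s ++ s'))).
rewrite (sum_tuple_cons (l + k)) (sum_tuple_cons l (fun s => \sum_(s' : k.-tuple T) f (s ++ s'))).
by apply: eq_bigr => z _; rewrite (IH (fun s => f (z :: s))).
Qed.

(** The weight [f] on the endpoint can stand for the sum over all continuations of the walk, which
    allows blocks to be chained. *)
Lemma sum_path_adjacency {F : nzRingType} {n} (e : rel 'I_n) l x (f : 'I_n -> F) :
  \sum_(s : l.-tuple 'I_n) (path e x s)%:R * f (last x s) =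
  \sum_z (adjacency F e ^+ l) x z * f z.
Proof.
elim: l x => [|l IH] x.
  rewrite (sum_tuple0 (fun s => (path e x s)%:R * f (last x s))) mul1r expr0.
  rewrite (bigD1 x) //= mxE eqxx mul1r big1 ?addr0 // => z zx.
  by rewrite mxE eq_sym (negPf zx) mul0r.
rewrite (sum_tuple_cons l (fun s => (path e x s)%:R * f (last x s))) /=.
transitivity (\sum_y (e x y)%:R * \sum_z (adjacency F e ^+ l) y z * f z).
  apply: eq_bigr => y _; rewrite -IH mulr_sumr; apply: eq_bigr => s _.
  by rewrite -mulnb natrM mulrA.
under [LHS]eq_bigr do rewrite mulr_sumr.
rewrite exchange_big; apply: eq_bigr => z _ /=.
rewrite exprS mxE mulr_suml; apply: eq_bigr => y _.
by rewrite mxE mulrA.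
Qed.

(** The tuple lists the [l] interior vertices; arriving at [y] is one step more. *)
Lemma sum_closing_path_adjacency {F : nzRingType} {n} (e : rel 'I_n) l x y :
  \sum_(s : l.-tuple 'I_n) (path e x (rcons s y))%:R = (adjacency F e ^+ l.+1) x y.
Proof.
rewrite exprSr mxE.
rewrite (eq_bigr (fun z => (adjacency F e ^+ l) x z * (e z y)%:R)) => [|z _]; last by rewrite [adjacency _ _ _ _]mxE.
rewrite -(sum_path_adjacency e l x (fun z => (e z y)%:R)).
by apply: eq_bigr => s _; rewrite rcons_path -mulnb natrM.
Qed.

(** Multiplying on the right kills the columns in [S]: entering [S] is forbidden, starting in it is
    not. *)
Lemma adjacency_avoid {F : nzRingType} {n} (e : rel 'I_n) (S : {set 'I_n}) :
  adjacency F (fun x z => e x z && (z \notin S)) = adjacency F e *m avoid_mx S.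
Proof.
by apply/matrixP => i j; rewrite /avoid_mx mul_mx_diag !mxE -mulnb natrM.
Qed.

(** * Cycle homomorphisms as closed walks *)

Lemma cycle_hom_setE {n t} (e : rel 'I_n) (s : t.+1.-tuple 'I_n) :
  symmetric e ->
  ([ffun i => tnth s i] \in hom_set (cycle_graph t.+1) e) = cycle e s.
Proof.
move=> esym.
have step (i : 'I_t.+1) : tnth s (ordS i) = if (i < t)%N then nth (tnth s i) s i.+1 else nth (tnth s i) s 0.
  rewrite (tnth_nth (tnth s i)) /=.
  have := ltn_ord i; rewrite ltnS leq_eqVlt => /orP[/eqP ->|it].
    by rewrite ltnn modnn.
  by rewrite it modn_small.
(* The closed walk follows the successor orientation of the cycle; the opposite one comes from the
   symmetry of [e]. *)
have cyc : cycle e s <-> forall i : 'I_t.+1, e (tnth s i) (tnth s (ordS i)).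
  case: (tupleP s) step => x p step.
  have nthi (i : 'I_t.+1) y : nth y (x :: rcons p x) i = tnth [tuple of x :: p] i.
    rewrite (tnth_nth x) -rcons_cons nth_rcons /= size_tuple ltn_ord.
    by apply: set_nth_default; rewrite /= size_tuple.
  have nthS (i : 'I_t.+1) y : nth y (rcons p x) i = tnth [tuple of x :: p] (ordS i).
    rewrite step nth_rcons size_tuple; case: ltnP => [it|ti] /=.
      by apply: set_nth_default; rewrite size_tuple.
    by rewrite ifT // eqn_leq ti andbT -ltnS.
  rewrite /=; split.
    move=> /(pathP x) H i; rewrite -(nthi i x) -(nthS i x); apply: H.
    by rewrite size_rcons size_tuple.
  move=> H; apply/(pathP x) => i; rewrite size_rcons size_tuple => it.
  by rewrite (nthi (Ordinal it)) (nthS (Ordinal it)).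
apply/idP/idP => [|/cyc H].
  rewrite inE => /forallP H; apply/cyc => i.
  have /forallP/(_ (ordS i)) := H i; rewrite /cycle_graph eqxx /= !ffunE.
  exact.
rewrite inE; apply/forallP => i; apply/forallP => j; rewrite !ffunE.
apply/implyP => /orP[/eqP ->|/eqP ->]; first exact: H.
by rewrite esym.
Qed.

Lemma sum_ffun_tuple {F : nmodType} {T : finType} t (f : {ffun 'I_t -> T} -> F) :
  \sum_g f g = \sum_(s : t.-tuple T) f [ffun i => tnth s i].
Proof.
rewrite (reindex (fun s : t.-tuple T => [ffun i => tnth s i])) //=.
exists (fun g : {ffun 'I_t -> T} => [tuple g i | i < t]) => [s _|g _].
  by apply: eq_from_tnth => i; rewrite tnth_mktuple ffunE.
by apply/ffunP => i; rewrite ffunE tnth_mktuple.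
Qed.

Lemma hom_cycleE {F : pzSemiRingType} {n t} (e : rel 'I_n) :
  symmetric e -> (graph_hom (cycle_graph t.+1) e)%:R =
    \sum_(s : t.+1.-tuple 'I_n) (cycle e s)%:R :> F.
Proof.
move=> esym; rewrite /graph_hom -sum1_card natr_sum big_mkcond sum_ffun_tuple.
by apply: eq_bigr => s _; rewrite cycle_hom_setE //; case: cycle.
Qed.

Lemma mon_cycleE {F : pzSemiRingType} {n t} (e : rel 'I_n) :
  symmetric e -> (graph_mon (cycle_graph t.+1) e)%:R =
    \sum_(s : t.+1.-tuple 'I_n) (cycle e s && uniq s)%:R :> F.
Proof.
move=> esym; rewrite /graph_mon -sum1_card natr_sum big_mkcond sum_ffun_tuple.
apply: eq_bigr => s _; rewrite inE cycle_hom_setE //.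
have -> : injectiveb [ffun i => tnth s i] = uniq s.
  rewrite -[in RHS](map_tnth_enum s) /injectiveb /dinjectiveb; congr uniq.
  by apply: eq_map => i; rewrite ffunE.
by case: (_ && _).
Qed.

Lemma hom_cycle_trace {F : nzRingType} {n t} (e : rel 'I_n) :
  symmetric e -> (graph_hom (cycle_graph t.+1) e)%:R = \tr (adjacency F e ^+ t.+1).
Proof.
move=> esym; rewrite hom_cycleE // (sum_tuple_cons t (fun s => (cycle e s)%:R)).
by apply: eq_bigr => x _; rewrite -sum_closing_path_adjacency.
Qed.

(** * Upper bounds for injective homomorphisms *)

Lemma sum_path_regular {F : comNzRingType} {n} (e : rel 'I_n) d l x :
  regular e d -> \sum_(s : l.-tuple 'I_n) (path e x s)%:R = d%:R ^+ l :> F.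
Proof.
move=> reg; elim: l x => [|l IH] x.
  by rewrite (sum_tuple0 (fun s => (path e x s)%:R)).
rewrite (sum_tuple_cons l (fun s => (path e x s)%:R)) /=.
transitivity (\sum_y (e x y)%:R * (d%:R ^+ l : F)).
  apply: eq_bigr => y _; rewrite -(IH y) mulr_sumr; apply: eq_bigr => s _.
  by rewrite -mulnb natrM.
by rewrite -mulr_suml (adjacency_row_sum _ _ _ reg) exprS.
Qed.

(** Distinctness keeps the vertex after [y] away from its neighbour [x], so each step has at most
    [d - 1] choices. *)
Lemma sum_uniq_path_le {F : realFieldType} {n} (e : rel 'I_n) d l x y :
  symmetric e -> regular e d -> e x y ->
  \sum_(s : l.-tuple 'I_n) (path e y s && uniq (x :: y :: s))%:R <= (d%:R - 1) ^+ l :> F.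
Proof.
move=> esym reg; elim: l x y => [|l IH] x y exy.
  rewrite (sum_tuple0 (fun s => (path e y s && uniq (x :: y :: s))%:R)) expr0.
  by case: (_ && _); rewrite ?lexx ?ler01.
rewrite (sum_tuple_cons l (fun s => (path e y s && uniq (x :: y :: s))%:R)).
have deg : \sum_z (e y z && (z != x))%:R = d%:R - 1 :> F.
  rewrite -(adjacency_row_sum _ _ y reg) (bigD1 x) // [in RHS](bigD1 x) //=.
  rewrite eqxx andbF add0r esym exy addrC addrK; apply: eq_bigr => z zx.
  by rewrite zx andbT.
rewrite exprS -{1}deg mulr_suml; apply: ler_sum => z _.
have [/andP[eyz zx]|/nandP yzx] := boolP (e y z && (z != x)); last first.
  rewrite mul0r big1 // => s _ /=; case: yzx => [/negPf -> //|/negPn/eqP ->].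
  by rewrite !inE eqxx !orbT /= andbF.
rewrite mul1r; apply: le_trans (IH _ _ eyz); apply: ler_sum => s _.
by apply: ler_bool => /= /andP[/andP[_ ->] /andP[_ ->]].
Qed.

(** The closed walk is cut as [x], [y], [p], [q]: [d] choices for [y], at most [d - 1] for each of
    the [k] steps along [p], and the mixing bound [B] for the last [g + h] steps. *)
Lemma mon_le_nonbacktracking {F : realFieldType} {n} (e : rel 'I_n) d (rho eta : F) k g h t :
  simple_graph e -> regular e d -> (0 < n)%N -> (0 < d)%N ->
  expander_mx (adjacency F e) d%:R rho -> 0 <= rho <= 1 -> 0 <= eta ->
  n%:R * rho ^+ g <= eta -> n%:R * rho ^+ h <= eta ->
  t.+1 = (k.+1 + (g + h))%N -> (0 < g)%N ->
  (graph_mon (cycle_graph t.+1) e)%:R <= d%:R ^+ t.+1 * ((1 + eta) * (1 - d%:R^-1) ^+ k) :> F.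
Proof.
move=> [esym _] reg n0 d0 HA rho01 eta0 Hg Hh tE g0.
(* The [g + h] closing steps pass through [r] intermediate vertices, the entries of [q]. *)
have [r rE] : exists r, (g + h = r.+1)%N by case: (g) g0 => // g' _; exists (g' + h)%N.
rewrite mon_cycleE //.
have -> : t.+1 = (k + r).+2 by rewrite tE rE addnS.
rewrite (sum_tuple_cons (k + r).+1 (fun s => (cycle e s && uniq s)%:R)).
have dR : 0 < d%:R :> F by rewrite ltr0n.
have nR : 0 < n%:R :> F by rewrite ltr0n.
pose B : F := d%:R ^+ r.+1 * ((1 + eta) / n%:R).
have B0 : 0 <= B by rewrite mulr_ge0 ?exprn_ge0 ?divr_ge0 ?addr_ge0.
have close z x : \sum_(s : r.-tuple 'I_n) (path e z (rcons s x))%:R <= B.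
  rewrite sum_closing_path_adjacency -rE exprD.
  (* With no forbidden vertex and no avoiding step only the mixing bound remains. *)
  have := expander_entry_le _ _ _ _ finset.set0 g 0 h x z HA (ltW dR) rho01 eta0 Hg Hh.
  by rewrite !expr0 mulmx1 mulr1 addn0 rE.
apply: le_trans (_ : _ <= \sum_(x < n) (d%:R * ((d%:R - 1) ^+ k * B))) _; last first.
  rewrite sumr_const card_ord -[_ *+ n]mulr_natl.
  have -> : (1 - d%:R^-1) ^+ k = (d%:R - 1) ^+ k / d%:R ^+ k :> F.
    by rewrite -exprVn -exprMn mulrBl mulfV ?gt_eqF ?mul1r.
  rewrite /B le_eqVlt; apply/orP; left; apply/eqP.
  rewrite -addnS -addSn exprD (exprS _ k); field.
  by rewrite !gt_eqF ?exprn_gt0.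
apply: ler_sum => x _.
rewrite (sum_tuple_cons (k + r) (fun s => (cycle e (x :: s) && uniq (x :: s))%:R)).
rewrite -{1}(adjacency_row_sum _ _ x reg) mulr_suml; apply: ler_sum => y _.
rewrite (sum_tuple_cat k r (fun s => (cycle e (x :: y :: s) && uniq (x :: y :: s))%:R)).
have [exy|nexy] := boolP (e x y); last first.
  rewrite mul0r big1 // => p _; rewrite big1 // => q _.
  by rewrite /= (negPf nexy).
rewrite mul1r.
apply: le_trans (_ : _ <= (\sum_(p : k.-tuple 'I_n) (path e y p && uniq (x :: y :: p))%:R) * B) _.
  rewrite mulr_suml; apply: ler_sum => p _.
  apply: le_trans (_ : _ <= (path e y p && uniq (x :: y :: p))%:R *
     \sum_(q : r.-tuple 'I_n) (path e (last y p) (rcons q x))%:R) _.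
    rewrite mulr_sumr; apply: ler_sum => q _; rewrite -natrM mulnb; apply: ler_bool.
    move=> /andP[cyc U].
    have : uniq ([:: x, y & p] ++ q) by exact: U.
    rewrite cat_uniq => /andP[-> _]; rewrite andbT.
    by move: cyc; rewrite /= rcons_cat cat_path => /and3P[_ -> ->].
  by apply: ler_wpM2l.
by apply: ler_wpM2r B0 _ _ _; apply: sum_uniq_path_le.
Qed.

(* A closed walk is cut as x, p, q1, q2, q3 with p and q1 of length h, q2 of length
   2h and q3 of length k; q2 must avoid the vertices of p, while q1 and q3 only serve
   to mix. *)
Lemma mon_le_avoiding {F : realFieldType} {n} (e : rel 'I_n) d (rho eta theta : F) h k t :
  simple_graph e -> regular e d -> (0 < n)%N ->
  expander_mx (adjacency F e) d%:R rho -> 0 <= rho <= 1 -> 0 <= eta -> 0 <= theta ->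
  n%:R * rho ^+ h <= eta -> n%:R * rho ^+ k.+1 <= eta ->
  ((h <= n)%N -> (1 - (1 - rho ^+ 2) * (h%:R / n%:R)) ^+ h <= theta) ->
  t = (h + (h + (2 * h + k)))%N -> (0 < h)%N ->
  (graph_mon (cycle_graph t.+1) e)%:R <= d%:R ^+ t.+1 * ((1 + eta) * theta) :> F.
Proof.
move=> [esym _] reg n0 HA rho01 eta0 theta0 Hh Hk Hth tE h0.
rewrite mon_cycleE // tE.
set m := (h + (2 * h + k))%N.
rewrite (sum_tuple_cons (h + m) (fun s => (cycle e s && uniq s)%:R)).
have dR : 0 <= d%:R :> F by [].
have nR : 0 < n%:R :> F by rewrite ltr0n.
pose B : F := d%:R ^+ m.+1 * ((1 + eta) / n%:R * theta).
have e0 : 0 <= (1 + eta) / n%:R by rewrite divr_ge0 ?addr_ge0.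
have B0 : 0 <= B by rewrite mulr_ge0 ?exprn_ge0 // mulr_ge0.
pose e' (S : {set 'I_n}) : rel 'I_n := fun a b => e a b && (b \notin S).
have close y x (S : {set 'I_n}) : #|S| = h ->
  \sum_(q1 : h.-tuple 'I_n) \sum_(q2 : (2 * h).-tuple 'I_n) \sum_(q3 : k.-tuple 'I_n)
    (path e y q1)%:R * ((path (e' S) (last y q1) q2)%:R *
     (path e (last (last y q1) q2) (rcons q3 x))%:R) <= B.
  move=> Sh.
  have -> : \sum_(q1 : h.-tuple 'I_n) \sum_(q2 : (2 * h).-tuple 'I_n) \sum_(q3 : k.-tuple 'I_n)
    (path e y q1)%:R * ((path (e' S) (last y q1) q2)%:R *
     (path e (last (last y q1) q2) (rcons q3 x))%:R) =
    (adjacency F e ^+ h *m (adjacency F e *m avoid_mx S) ^+ (2 * h)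
      *m adjacency F e ^+ k.+1) y x.
    rewrite -mulmxA mxE -(sum_path_adjacency e h y); apply: eq_bigr => q1 _.
    under eq_bigr do rewrite -!mulr_sumr.
    rewrite -mulr_sumr; congr (_ * _).
    rewrite mxE -adjacency_avoid -/(e' S)
      -(sum_path_adjacency (e' S) (2 * h) (last y q1)); apply: eq_bigr => q2 _.
    by rewrite sum_closing_path_adjacency.
  apply: le_trans (expander_entry_le _ _ _ _ S h h k.+1 x y HA dR rho01 eta0 Hh Hk) _.
  rewrite addnS -addnA /B Sh; apply: ler_wpM2l; first exact: exprn_ge0.
  (* The set [S] has [h] of the [n] vertices, so [h <= n] and the bound by [theta] is available. *)
  apply: ler_wpM2l => //; apply: Hth.
  by rewrite -Sh -[X in (_ <= X)%N]card_ord max_card.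
apply: le_trans (_ : _ <= \sum_(x < n) (d%:R ^+ h * B)) _; last first.
  rewrite sumr_const card_ord -[_ *+ n]mulr_natl.
  rewrite /B le_eqVlt; apply/orP; left; apply/eqP.
  rewrite -addnS exprD; field.
  by rewrite !gt_eqF ?exprn_gt0.
apply: ler_sum => x _.
rewrite (sum_tuple_cat h m (fun s => (cycle e (x :: s) && uniq (x :: s))%:R)).
rewrite -(sum_path_regular e d h x reg) mulr_suml; apply: ler_sum => p _.
(* The start [x] is not added, so [S] has exactly [h] elements when [p] is repetition-free. *)
pose S := [set z in val p].
have [up|nup] := boolP (uniq p); last first.
  rewrite big1 => [|q _]; first by apply: mulr_ge0 B0; exact: ler0n.
  by rewrite /= cat_uniq (negPf nup) /= !andbF.
have Sh : #|S| = h by rewrite cardsE (card_uniqP up) size_tuple.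
apply: le_trans (_ : _ <= (path e x p)%:R * _) _; last first.
  by apply: ler_wpM2l; [exact: ler0n|exact: (close (last x p) x S Sh)].
rewrite (sum_tuple_cat h (2 * h + k) (fun s => (cycle e (x :: p ++ s) && uniq (x :: p ++ s))%:R)).
rewrite mulr_sumr; apply: ler_sum => q1 _.
rewrite (sum_tuple_cat (2 * h) k (fun s => (cycle e (x :: p ++ q1 ++ s) && uniq (x :: p ++ q1 ++ s))%:R)).
rewrite mulr_sumr; apply: ler_sum => q2 _.
rewrite mulr_sumr; apply: ler_sum => q3 _.
rewrite -!natrM !mulnb; apply: ler_bool.
rewrite /cycle !rcons_cat !cat_path => /andP[/and4P[-> -> eq2 ->]] /=.
rewrite !cat_uniq => /and3P[_ _ /andP[hasN _]].
rewrite andbT /=.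
have : all (fun b => b \notin S) q2.
  apply/allP => b bq2; apply: contra hasN => bS; apply/hasP; exists b.
    by rewrite !mem_cat bq2 orbT.
  by rewrite inE in bS.
(* Avoidance, known for [q2] as a whole, is distributed over its single steps. *)
elim: (val q2) (last _ q1) eq2 => //= b q IH a /andP[eab eq] /andP[bS aq].
by rewrite {1}/e' eab bS /=; exact: IH.
Qed.

(** * Asymptotics *)

Local Open Scope classical_set_scope.
Local Open Scope ring_scope.

Lemma eventually_ge_nat {R : realType} (x : R) :
  exists N0 : nat, forall N : nat, (N0 <= N)%N -> x <= N%:R.
Proof.
exists (Num.bound `|x|) => N le_N; apply: le_trans (ler_norm _) _.
apply: le_trans (ltW (archi_boundP _)) _; first exact: normr_ge0.
by rewrite ler_nat.
Qed.

(** With [q] the fourth root of [N], [ln N = 4 ln q <= 4 q], and the threshold ensures [4 |M| <= q],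
    whence the bound [q ^+ 2]. *)
Lemma eventually_ln_le_sqrt {R : realType} (M : R) :
  exists N0 : nat, forall N : nat, (N0 <= N)%N -> M * ln (N%:R : R) <= Num.sqrt N%:R.
Proof.
have [N0 HN0] := eventually_ge_nat (1 + (4 * `|M|) ^+ 4).
exists N0 => N /HN0 le_N.
have M0 := normr_ge0 M.
have M4 : 0 <= (4 * `|M|) ^+ 4 by rewrite exprn_ge0 // mulr_ge0.
have N1 : 1 <= N%:R :> R by lra.
set q := Num.sqrt (Num.sqrt (N%:R : R)).
have q0 : 0 <= q by exact: sqrtr_ge0.
have q2 : q ^+ 2 = Num.sqrt N%:R by rewrite sqr_sqrtr ?sqrtr_ge0.
have q4 : q ^+ 4 = N%:R by rewrite -[4%N]/(2 * 2)%N exprM q2 sqr_sqrtr ?ler0n.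
have q_gt0 : 0 < q by rewrite lt_def q0 andbT; apply/eqP => qE; move: q4; rewrite qE expr0n /=; lra.
have Mq : 4 * `|M| <= q.
  rewrite -(ler_pXn2r (ltn0Sn 3)) ?nnegrE ?mulr_ge0 // q4; lra.
rewrite -{1}q4 lnXn // -q2.
have lnq : ln q <= q.
  by have := @le_ln1Dx R (q - 1); rewrite [1 + _]addrC subrK; lra.
have ln0 : 0 <= ln (q ^+ 4) by rewrite q4 ln_ge0.
rewrite lnXn // in ln0.
apply: le_trans (_ : _ <= `|M| * (ln q *+ 4)) _.
  by apply: ler_wpM2r => //; exact: ler_norm.
have : `|M| * (ln q *+ 4) <= `|M| * (q *+ 4).
  by apply: ler_wpM2l => //; rewrite lerMn2r.
nra.
Qed.

Lemma expr_le_expRM {R : realType} (x y : R) k :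
  0 <= 1 - x -> y <= x * k%:R -> (1 - x) ^+ k <= expR (- y).
Proof.
move=> x1 yk; apply: le_trans (_ : _ <= expR (- x) ^+ k) _.
  by apply: lerXn2r; rewrite ?nnegrE ?expR_ge0 ?expR_ge1Dx.
by rewrite -expRM_natr ler_expR mulNr lerN2.
Qed.

(** * Comparison of the two counts *)

Lemma mon_cycle_lt {R : realType} {n} (e : rel 'I_n) d (rho eta theta c : R) t h :
  simple_graph e -> regular e d -> (0 < n)%N -> (0 < d)%N ->
  expander_mx (adjacency R e) d%:R rho -> 0 < rho < 1 ->
  0 < eta -> theta = 1 - eta *+ 8 ->
  0 < c -> expR (- (c / 12%:R)) <= theta ->
  expR (- ((1 - rho ^+ 2) * (c / 12%:R) ^+ 2)) <= theta ->
  (0 < h)%N -> (6 * h <= t)%N -> t%:R <= 12%:R * h%:R :> R ->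
  n%:R * rho ^+ h <= eta ->
  c * Num.min (Num.sqrt n%:R) d%:R < t%:R ->
  (graph_mon (cycle_graph t) e)%:R < (1 - eta) * (graph_hom (cycle_graph t) e)%:R :> R.
Proof.
move=> sg reg n0 d0 HA /andP[rho0 rho1] eta0 thE c0 thA thB h0 ht th Hh tmin.
have [esym _] := sg.
have dR : 0 < d%:R :> R by rewrite ltr0n.
have nR : 0 < n%:R :> R by rewrite ltr0n.
have th0 : 0 <= theta := le_trans (expR_ge0 _) thA.
have rho01 : 0 <= rho <= 1 by rewrite !ltW.
have decay l : (h <= l)%N -> n%:R * rho ^+ l <= eta.
  move=> hl; apply: le_trans Hh; apply: ler_wpM2l; first exact: ltW.
  by apply: ler_wiXn2l => //; exact: ltW.
case: t ht th tmin => [|t]; first by move: h0; clear; lia.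
move=> ht th tmin.
have hom_ge : d%:R ^+ t.+1 * (1 - eta) <= (graph_hom (cycle_graph t.+1) e)%:R :> R.
  rewrite hom_cycle_trace //.
  apply: le_trans (expander_trace_ge _ _ _ t.+1 n0 HA (ltW dR) (ltW rho0)).
  apply: ler_wpM2l; first by rewrite exprn_ge0 // ltW.
  by rewrite lerD2l lerN2 decay //; move: ht; clear; lia.
have mon_le : (graph_mon (cycle_graph t.+1) e)%:R <= d%:R ^+ t.+1 * ((1 + eta) * theta) :> R.
  have [sd|ds] := leP (Num.sqrt n%:R) (d%:R : R).
    rewrite min_l // in tmin.
    (* The earlier blocks take [4 * h] of at least [6 * h] steps, which leaves enough for the last
       block to mix. *)
    have [k kE] : exists k, t = (h + (h + (2 * h + k)))%N.
      by exists (t - 4 * h)%N; move: ht h0; clear; lia.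
    have hk : (h <= k.+1)%N by move: ht kE h0; clear; lia.
    apply: (mon_le_avoiding e d rho eta theta h k t sg reg n0 HA rho01 (ltW eta0) th0
      Hh (decay _ hk) _ kE h0).
    move=> hn; apply: le_trans thB.
    have hn1 : h%:R / n%:R <= 1 :> R by rewrite ler_pdivrMr // mul1r ler_nat.
    have hn0 : 0 <= h%:R / n%:R :> R by rewrite divr_ge0.
    have r2 : 0 < 1 - rho ^+ 2 by rewrite subr_gt0 expr_lt1 ?ltW.
    apply: expr_le_expRM; first by have := sqr_ge0 rho; nra.
    rewrite -mulrA; apply: ler_wpM2l; first exact: ltW.
    (* Being at least a twelfth of the cycle length, [h] exceeds [c / 12] times the root of [n];
       squaring gives the exponent. *)
    rewrite mulrAC ler_pdivlMr // -(sqr_sqrtr (ltW nR)) -exprMn -expr2.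
    have s0 := sqrtr_ge0 (n%:R : R).
    have c12 : 0 <= c / 12%:R by rewrite divr_ge0 // ltW.
    by apply: lerXn2r; rewrite ?nnegrE ?mulr_ge0 //; lra.
  rewrite min_r ?ltW // in tmin.
  have [k kE] : exists k, t.+1 = (h.+1 + (h + k))%N.
    by exists (t - 2 * h)%N; move: ht h0; clear; lia.
  have hk : (h <= k)%N by move: ht kE h0; clear; lia.
  apply: le_trans (mon_le_nonbacktracking e d rho eta h h k t sg reg n0 d0 HA rho01
    (ltW eta0) Hh (decay _ hk) kE h0) _.
  apply: ler_wpM2l; first by rewrite exprn_ge0 // ltW.
  apply: ler_wpM2l; first by lra.
  apply: le_trans thA; apply: expr_le_expRM.
    by rewrite subr_ge0 invf_le1 // ler1n.
  by rewrite [leRHS]mulrC ler_pdivlMr //; lra.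
apply: le_lt_trans mon_le _.
apply: lt_le_trans (_ : (1 - eta) * (d%:R ^+ t.+1 * (1 - eta)) <= _); last first.
  by apply: ler_wpM2l => //; lra.
(* What remains is [(1 + eta) * (1 - 8 * eta) < (1 - eta) ^+ 2]. *)
rewrite [ltRHS]mulrCA ltr_pM2l ?exprn_gt0 // thE.
nra.
Qed.

Theorem theorem4 (R : realType) (G : forall N : nat, rel 'I_N) (N1 : nat -> nat) :
  (* standing assumptions on the sequence (for all large N) *)
  (exists N0 : nat, forall N : nat, (N0 <= N)%N ->
     [/\ simple_graph (G N), connected_graph (G N), ~ bipartite (G N)
       & regular (G N) (N1 N)]) ->
  (* spectral expander: |lambda_1| / N_1 < 1 - delta for all large N *)
  (exists2 delta : R, 0 < delta &
     exists N0 : nat, forall N : nat, (N0 <= N)%N ->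
       forall a : R, eigenvalue (adjacency R (G N)) a -> a != (N1 N)%:R ->
         `|a| / (N1 N)%:R < 1 - delta) ->
  (* N_1 / ln N -> +oo *)
  ((fun N : nat => (N1 N)%:R / ln (N%:R : R)) @ \oo --> +oo) ->
  forall c : R, 0 < c ->
  exists2 eps : R, 0 < eps &
    exists N0 : nat, forall N : nat, (N0 <= N)%N ->
      forall t : nat, c * Num.min (Num.sqrt (N%:R : R)) (N1 N)%:R < t%:R ->
        (graph_mon (cycle_graph t) (G N))%:R < (1 - eps) * (graph_hom (cycle_graph t) (G N))%:R.
Proof.
move=> [Ng Hg] [delta delta0 [Ns Hs]] Hln c c0.
(* [1 - delta] could be nonpositive; the maximum keeps [ln rho] meaningful. *)
pose rho := Num.max (1 - delta) (1 / 2%:R).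
have rho12 : 1 / 2%:R <= rho by rewrite le_max lexx orbT.
have rho1 : rho < 1 by rewrite gt_max; apply/andP; split; lra.
have rho0 : 0 < rho by lra.
have rho01 : 0 < rho < 1 by rewrite rho0.
(* One term for each regime, degree below the root of [N] or not; both depend only on [c] and [rho],
   so the final [eta] is uniform in [N] and [t]. *)
pose theta := Num.max (expR (- (c / 12%:R))) (expR (- ((1 - rho ^+ 2) * (c / 12%:R) ^+ 2))).
have theta1 : theta < 1.
  have c12 : 0 < c / 12%:R by rewrite divr_gt0.
  rewrite gt_max !expR_lt1 !oppr_lt0 c12 /= mulr_gt0 ?exprn_gt0 //.
  by rewrite subr_gt0 expr_lt1 ?ltW.
(* One [eta] is lost to mixing, one to the trace bound and one is the claimed gain; an eighth of the
   gap covers all three. *)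
pose eta := (1 - theta) / 8%:R.
have eta0 : 0 < eta by rewrite divr_gt0 // subr_gt0.
have thE : theta = 1 - eta *+ 8 by rewrite /eta; lra.
have lnrho : 0 < - ln rho by rewrite oppr_gt0 ln_lt0.
(* With [h >= K ln N] one has [rho ^+ h <= N ^ -2]; the constant M turns both
   [M ln N <= sqrt N] and [M ln N <= N1] into that bound for [h = t / 6]. *)
pose K := 2%:R / (- ln rho).
have K0 : 0 < K by rewrite divr_gt0.
pose M := (6%:R + 12%:R * K) / c.
have M0 : 0 < M by rewrite divr_gt0 // addr_gt0 // mulr_gt0.
have cM : c * M = 6%:R + 12%:R * K by rewrite /M; field; rewrite gt_eqF.
have [Nq Hq] := eventually_ln_le_sqrt M.
(* Beyond [expR 1] one has [ln N >= 1]; beyond [eta^-1] the error [1 / N] is at most [eta]. *)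
have [Ne He] := @eventually_ge_nat R (expR 1).
have [Ni Hi] := eventually_ge_nat eta^-1.
have /cvgryPge/(_ M)[Nd _ Hd] := Hln.
exists eta => //.
exists (Ng + Ns + Nq + Ne + Ni + Nd)%N => N le_N t tmin.
have [sg conn _ reg] : [/\ simple_graph (G N), connected_graph (G N), ~ bipartite (G N)
       & regular (G N) (N1 N)] by apply: Hg; move: le_N; clear; lia.
have e1N : expR 1 <= N%:R :> R by apply: He; move: le_N; clear; lia.
have iN : eta^-1 <= N%:R by apply: Hi; move: le_N; clear; lia.
have qN : M * ln (N%:R : R) <= Num.sqrt N%:R by apply: Hq; move: le_N; clear; lia.
have NR : 0 < N%:R :> R by apply: lt_le_trans e1N; exact: expR_gt0.
have N0 : (0 < N)%N by rewrite -(ltr0n R).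
have lnN1 : 1 <= ln (N%:R : R) by rewrite -ler_expR lnK // posrE.
have dN : M * ln (N%:R : R) <= (N1 N)%:R.
  rewrite -ler_pdivlMr; last by lra.
  by apply: Hd => /=; move: le_N; clear; lia.
have d0 : (0 < N1 N)%N.
  by rewrite -(ltr0n R); apply: lt_le_trans dN; rewrite mulr_gt0 //; lra.
have dR : 0 < (N1 N)%:R :> R by rewrite ltr0n.
have HA : expander_mx (adjacency R (G N)) (N1 N)%:R rho.
  apply: expander_adjacency => // a eiga ad.
  have : `|a| / (N1 N)%:R < 1 - delta.
    by apply: Hs => //; move: le_N; clear; lia.
  move=> /ltW h1; rewrite -ler_pdivrMr //; apply: le_trans h1 _.
  by rewrite le_max lexx.
(* The summand 6 makes [h] positive; [12 * K] together with [t <= 12 * h] gives [K ln N <= h]. *)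
have t_ge : (6%:R + 12%:R * K) * ln N%:R < t%:R.
  apply: le_lt_trans tmin; rewrite -cM -mulrA; apply: ler_wpM2l; first exact: ltW.
  by rewrite le_min qN dN.
have t6 : (6 <= t)%N.
  rewrite -(ler_nat R); apply: le_trans (ltW t_ge).
  have : 0 <= K * ln N%:R by rewrite mulr_ge0 ?ltW //; lra.
  lra.
pose h := (t %/ 6)%N.
have h0 : (0 < h)%N by rewrite divn_gt0.
have h6 : (6 * h <= t)%N by rewrite mulnC leq_trunc_div.
(* The remainder is at most 5 and [h >= 1], so [t <= 6 * h + 5 <= 12 * h]. *)
have h12 : (t <= 12 * h)%N by move: (divn_eq t 6) (ltn_mod t 6) h0; rewrite -/h; clear; lia.
have h12R : t%:R <= 12%:R * h%:R :> R by rewrite -natrM ler_nat.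
apply: (mon_cycle_lt _ (N1 N) rho eta theta c t h) => //.
- by rewrite le_max lexx.
- by rewrite le_max lexx orbT.
have Kh : K * ln N%:R <= h%:R by lra.
have rhoh : rho ^+ h <= (N%:R ^+ 2)^-1.
  rewrite -[rho]lnK ?posrE // -expRM_natr -[N%:R]lnK ?posrE // -expRM_natr -expRN ler_expR.
  have : K * ln N%:R * (- ln rho) <= h%:R * (- ln rho) by apply: ler_wpM2r => //; exact: ltW.
  have -> : K * ln N%:R * (- ln rho) = 2%:R * ln N%:R by rewrite /K; field; lra.
  lra.
apply: le_trans (_ : N%:R * (N%:R ^+ 2)^-1 <= _).
  by apply: ler_wpM2l => //; exact: ltW.
by rewrite expr2 invfM mulrA mulfV ?gt_eqF // mul1r invf_ple ?posrE.
Qed.
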